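(* For any positive integer $n$, we have $$g(n)\leq n,$$ and equality holds if there exists a Hadamard matrix of order $n$.
   Context: For a positive integer $n$ let $\Omega=\{1,2,\ldots,n\}$. A set system on $\Omega$ is a collection $\mathcal{F}=\{A_1,\ldots,A_t\}$ of distinct subsets of $\Omega$. A set system $\mathcal{F}$ is called an intersecting family if $A\cap B\neq\emptyset$ for any $A,B\in\mathcal{F}$ (including $A=B$, so all members are nonempty). The number $g(n)$ denotes the maximum cardinality $t$ of an intersecting family $\mathcal{F}=\{A_1,\ldots,A_t\}$ on $\Omega$ satisfying $|A_i\cap A_j|=n^{-1}|A_i||A_j|$ for all $1\leq i<j\leq t$. A Hadamard matrix of order $n$ is an $n\times n$ matrix $H$ with all entries in $\{1,-1\}$ such that $HH^\top=nI_n$, where $I_n$ is the identity matrix of order $n$. *)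

(* Defs.v *)
From mathcomp Require Import all_boot all_order all_algebra.

Set Implicit Arguments.
Unset Strict Implicit.
Unset Printing Implicit Defensive.

Import GRing.Theory.

Local Open Scope ring_scope.

(* A and B need not be distinct, so no member of an intersecting family is
   empty. *)
Definition intersecting (T : finType) (F : {set {set T}}) : bool :=
  [forall A in F, forall B in F, A :&: B != set0].

Definition product_intersections (n : nat) (F : {set {set 'I_n}}) : bool :=
  [forall A in F, forall B in F, (A != B) ==>
    (#|A :&: B|%:R == n%:R^-1 * #|A|%:R * #|B|%:R :> rat)].

Definition g (n : nat) : nat :=
  \max_(F : {set {set 'I_n}} | intersecting F && product_intersections F) #|F|.

Definition hadamard (n : nat) (H : 'M[int]_n) : Prop :=
  (forall i j, H i j = 1 \/ H i j = -1) /\ H *m H^T = n%:R *: 1%:M.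

(* Main.v *)
Require Import Defs.
From mathcomp Require Import all_boot all_order all_algebra.
From mathcomp Require Import ring lra.

(** Upper bound: for A in the family put v_A = 1_A - (|A|/n) 1 if A <> Omega, and
    v_Omega = 1.  The vectors 1_A - (|A|/n) 1 are orthogonal to 1, and the
    intersection condition says that they are orthogonal to each other, so the
    v_A are nonzero and pairwise orthogonal in Q^n.

    Equality: given a Hadamard matrix H, let A_i be the set of columns where
    row i agrees with row 0.  Its indicator is (1 + H_ij H_0j)/2, so the
    orthogonality of the rows yields |A_i :&: A_k| = n (1 + [i=0] + [k=0] + [i=k]) / 4
    for all i, k, from which everything follows. *)

Set Implicit Arguments.
Unset Strict Implicit.
Unset Printing Implicit Defensive.

Import Order.TTheory GRing.Theory Num.Theory.

Local Open Scope ring_scope.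

(** The Gram matrix [M *m M^T] is diagonal with nonzero diagonal entries, hence invertible, so [M]
    has a right inverse and cannot have more rows than columns. *)
Lemma orthogonal_rows_leq (R : fieldType) (m n : nat) (M : 'M[R]_(m, n)) :
  (forall i k, i != k -> \sum_j M i j * M k j = 0) ->
  (forall i, \sum_j M i j * M i j != 0) -> (m <= n)%N.
Proof.
move=> orthM normM; set D := M *m M^T.
have DE i k : D i k = \sum_j M i j * M k j.
  by rewrite !mxE; apply: eq_bigr => j _; rewrite mxE.
have diagD : D = diag_mx (\row_i D i i).
  apply/matrixP=> i k; rewrite [RHS]mxE.
  by case: eqVneq => [-> | /orthM ik0]; rewrite ?mulr1n ?mulr0n ?DE // mxE DE.
have unitD : D \in unitmx.
  rewrite unitmxE diagD det_diag unitfE; apply/prodf_neq0 => i _.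
  by rewrite mxE DE.
by apply: (@mulmx1_min _ _ _ M (M^T *m invmx D)); rewrite mulmxA mulmxV.
Qed.

Lemma sum_indicator (R : pzSemiRingType) (T : finType) (A : {set T}) :
  \sum_j (j \in A)%:R = #|A|%:R :> R.
Proof. by rewrite -sum1_card natr_sum [RHS]big_mkcond; apply: eq_bigr => j _; case: ifP. Qed.

Definition centered (n : nat) (A : {set 'I_n}) (j : 'I_n) : rat :=
  (j \in A)%:R - #|A|%:R / n%:R.

Lemma sum_centered (n : nat) (A : {set 'I_n}) : (0 < n)%N ->
  \sum_j centered A j = 0.
Proof.
move=> n_gt0; rewrite sumrB sum_indicator sumr_const card_ord -[X in _ - X]mulr_natr divfK ?subrr //.
by rewrite pnatr_eq0 -lt0n.
Qed.

Lemma sum_centeredM (n : nat) (A B : {set 'I_n}) : (0 < n)%N ->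
  \sum_j centered A j * centered B j
  = #|A :&: B|%:R - n%:R^-1 * #|A|%:R * #|B|%:R.
Proof.
move=> n_gt0.
(* Only the second factor is expanded: its constant part contributes a multiple of the sum of
   [centered A], which is 0. *)
under eq_bigr => j _ do rewrite {2}/centered mulrBr.
rewrite sumrB -mulr_suml sum_centered // mul0r subr0.
under eq_bigr => j _ do rewrite mulrBl -natrM mulnb -in_setI.
by rewrite sumrB sum_indicator -mulr_sumr sum_indicator; congr (_ - _ * _); rewrite mulrC.
Qed.

Lemma product_intersections_card_leq (n : nat) (F : {set {set 'I_n}}) :
  (0 < n)%N -> intersecting F -> product_intersections F -> (#|F| <= n)%N.
Proof.
move=> n_gt0 /forall_inP intF /forall_inP prodF.
have nz : n%:R != 0 :> rat by rewrite pnatr_eq0 -lt0n.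
pose v (A : {set 'I_n}) j : rat := if A == setT then 1 else centered A j.
pose M := \matrix_(i < #|F|, j < n) v (enum_val i) j.
have ME A B : \sum_j M A j * M B j = \sum_j v (enum_val A) j * v (enum_val B) j.
  by apply: eq_bigr => j _; rewrite !mxE.
apply: (@orthogonal_rows_leq _ _ _ M) => [i k|i]; rewrite ME.
- rewrite -(inj_eq enum_val_inj); move: (enum_valP i) (enum_valP k).
  move: (enum_val i) (enum_val k) => A B AF BF neqAB; rewrite /v.
  case: (eqVneq A setT) => [A1|_]; case: (eqVneq B setT) => [B1|_].
  + by rewrite A1 B1 eqxx in neqAB.
  + by under eq_bigr do rewrite mul1r; rewrite sum_centered.
  + by under eq_bigr do rewrite mulr1; rewrite sum_centered.
  + rewrite sum_centeredM //; have /forall_inP/(_ B BF) := prodF A AF.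
    by rewrite neqAB => /eqP ->; rewrite subrr.
- move: (enum_valP i); move: (enum_val i) => A AF; rewrite /v.
  case: (eqVneq A setT) => [_|A1].
    by under eq_bigr do rewrite mulr1; rewrite sumr_const card_ord.
  rewrite sum_centeredM // setIid.
  have A0 : #|A|%:R != 0 :> rat.
    have /forall_inP/(_ A AF) := intF A AF.
    by rewrite setIid pnatr_eq0 cards_eq0.
  have An : n%:R - #|A|%:R != 0 :> rat.
    rewrite subr_eq0 eqr_nat eq_sym; apply: contraNneq A1 => cardA.
    by rewrite eqEcard subsetT cardsT card_ord cardA /=.
  (* The squared norm factors as |A|(n - |A|)/n, nonzero since A is neither empty nor the whole
     set. *)
  have -> : #|A|%:R - n%:R^-1 * #|A|%:R * #|A|%:R
            = n%:R^-1 * #|A|%:R * (n%:R - #|A|%:R) :> rat by field.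
  by rewrite !mulf_neq0 ?invr_eq0.
Qed.

Section Hadamard.

Variables (n : nat) (H : 'M[int]_n) (i0 : 'I_n).
Hypothesis hadH : hadamard H.

(** These are the positions of the entries 1 in row [i] once columns are negated to make row [i0]
    all ones; [agreement i0] is the whole set. *)
Definition agreement (i : 'I_n) : {set 'I_n} := [set j | H i j == H i0 j].

Let h i j : rat := (H i j)%:~R.

Lemma hadamard_indicator i j :
  (j \in agreement i)%:R = (1 + h i j * h i0 j) / 2%:R.
Proof.
rewrite inE /h; case: hadH => pm _.
by case: (pm i j) (pm i0 j) => -> [] ->; rewrite /=; field.
Qed.

Lemma hadamard_sum i k : \sum_j h i j * h k j = n%:R * (i == k)%:R.
Proof.
case: hadH => _ /matrixP/(_ i k); rewrite !mxE => /(congr1 (intr : int -> rat)).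
rewrite rmorph_sum rmorphM /= !rmorph_nat => <-.
by apply: eq_bigr => j _; rewrite mxE rmorphM.
Qed.

Lemma card_agreementI i k :
  #|agreement i :&: agreement k|%:R
  = n%:R * (1 + (i == i0)%:R + (k == i0)%:R + (i == k)%:R) / 4%:R :> rat.
Proof.
have sq j : h i0 j * h i0 j = 1.
  by rewrite /h; case: hadH => pm _; case: (pm i0 j) => ->.
rewrite -sum_indicator; under eq_bigr => j _.
  rewrite in_setI -mulnb natrM !hadamard_indicator.
  (* The square of [h i0 j] is kept apart so that [sq] removes it; what remains is a constant and
     three inner products of rows. *)
  have -> : (1 + h i j * h i0 j) / 2%:R * ((1 + h k j * h i0 j) / 2%:R)
    = (1 + h i j * h i0 j + h k j * h i0 j + h i j * h k j * (h i0 j * h i0 j))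
      / 4%:R by field.
  rewrite sq mulr1.
  over.
rewrite -mulr_suml !big_split /= !hadamard_sum sumr_const card_ord.
by rewrite !mulrDr mulr1.
Qed.

Lemma card_agreement i :
  #|agreement i|%:R = n%:R * (1 + (i == i0)%:R) / 2%:R :> rat.
Proof.
by rewrite -{1}[agreement i]setIid card_agreementI eqxx /=; field.
Qed.

Let n_neq0 : n%:R != 0 :> rat.
Proof. by rewrite pnatr_eq0 -lt0n (leq_trans _ (ltn_ord i0)). Qed.

(** If two distinct rows gave the same set, its size would also be that of the intersection. With a
    = [i = i0] and b = [k = i0], cancelling n gives 1 + a = b and 1 + b = a, which is absurd. *)
Lemma agreement_inj : injective agreement.
Proof.
move=> i k eqA; apply/eqP; apply: contraT => neq_ik.
have := card_agreementI i k; rewrite eqA setIid card_agreement (negPf neq_ik).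
have := card_agreementI i k; rewrite -eqA setIid card_agreement (negPf neq_ik).
have nn := n_neq0; move=> e1 e2.
have e : n%:R * (3%:R : rat) = n%:R * 0 \/ n%:R * (1 : rat) = n%:R * 0.
  by move: e1 e2; case: (i == i0); case: (k == i0) => /= e1 e2; lra.
by case: e => /(mulfI nn).
Qed.

Lemma intersecting_agreement : intersecting (agreement @: setT).
Proof.
apply/forall_inP => _ /imsetP[i _ ->]; apply/forall_inP => _ /imsetP[k _ ->].
(* The bracket is 1 plus natural numbers, hence a nonzero natural number, also for i = k. *)
rewrite -cards_eq0 -(pnatr_eq0 rat) card_agreementI !mulf_neq0 // nat1r -!natrD.
by rewrite pnatr_eq0.
Qed.

Lemma product_intersections_agreement :
  product_intersections (agreement @: setT).
Proof.
apply/forall_inP => _ /imsetP[i _ ->]; apply/forall_inP => _ /imsetP[k _ ->].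
rewrite (inj_eq agreement_inj); apply/implyP => neq_ik.
rewrite card_agreementI !card_agreement (negPf neq_ik); apply/eqP.
(* If one of the sets is the whole set, both sides equal n/2; otherwise both equal n/4. *)
have nn := n_neq0; case: (eqVneq i i0) neq_ik => [-> | _ _].
  by rewrite eq_sym => /negPf -> /=; field.
by case: (k == i0) => /=; field.
Qed.

End Hadamard.

Theorem theorem2p1 (n : nat) (n_gt0 : (0 < n)%N) :
  (g n <= n)%N /\ ((exists H : 'M[int]_n, hadamard H) -> g n = n).
Proof.
have le_gn : (g n <= n)%N.
  by apply/bigmax_leqP => F /andP[]; apply: product_intersections_card_leq.
split=> // -[H hadH]; apply/eqP; rewrite eqn_leq le_gn /=.
(* Positivity of n supplies row 0 as the reference row; injectivity then yields exactly n sets. *)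
have cardF := card_imset setT (agreement_inj (i0 := Ordinal n_gt0) hadH).
rewrite cardsT card_ord in cardF; rewrite -{1}cardF.
apply: leq_bigmax_cond.
by rewrite intersecting_agreement // product_intersections_agreement.
Qed.
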